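(* Let $\Pi\subseteq\mathbb{R}^n$ be a nonempty compact convex set and $h_1,\dots,h_k:\Pi\to\mathbb{R}_{\ge0}$ continuous concave functions; write $h(x)=(h_1(x),\dots,h_k(x))$. Define $f:\Theta\to\mathbb{R}$ and $g:\Xi\to\mathbb{R}$ by $f(\theta)=\max_{x\in\Pi}\langle\theta,h(x)\rangle$ and $g(\xi)=\max_{x\in\Pi}\min_{i\in[k]}h_i(x)/\xi_i$. Then $f$ and $g$ are continuous, $f$ is convex, and \[ g(\xi)=\min_{\theta\in\Theta(\xi)}\frac{f(\theta)}{\langle\theta,\xi\rangle}\ \ (\xi\in\Xi),\qquad f(\theta)=\max_{\xi\in\Xi}g(\xi)\langle\theta,\xi\rangle\ \ (\theta\in\Theta). \]
   Context: $\Theta=\{\theta\in\mathbb{R}^k:\theta_i\ge0,\sum_i\theta_i=1\}$, $\Xi=\{\xi\in\mathbb{R}^k:\xi_i\ge0,\max_i\xi_i=1\}$, $\Theta(\xi)=\{\theta\in\Theta:\theta_i=0\text{ whenever }\xi_i=0\}$, $\langle v,w\rangle=\sum_iv_iw_i$. Convention: $h_i(x)/\xi_i=+\infty$ if $\xi_i=0$.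
   Formalization: Continuity of g is asserted only when either all h_i vanish identically on Π or none does; otherwise g is always discontinuous: e.g. for h_1=1, h_2=0 one has g(1,0)=1 but g(1,ε)=0 for 0<ε≤1. *)

(* Defs.v *)
From HB Require Import structures.
From mathcomp Require Import all_boot all_order all_algebra.
From mathcomp Require Import all_classical all_reals all_analysis.

Set Implicit Arguments.
Unset Strict Implicit.
Unset Printing Implicit Defensive.

Import Order.TTheory GRing.Theory Num.Theory.
Import numFieldNormedType.Exports.

Local Open Scope classical_set_scope.
Local Open Scope ring_scope.
Local Open Scope convex_scope.

Definition is_max {d : Order.disp_t} {T : porderType d} (A : set T) (m : T) :
  Prop := A m /\ ubound A m.

Definition is_min {d : Order.disp_t} {T : porderType d} (A : set T) (m : T) :
  Prop := A m /\ lbound A m.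

Definition concave_function {R : numFieldType} {E : lmodType R}
    (D : set (convex_lmodType E)) (f : convex_lmodType E -> R^o) : Prop :=
  forall t : {i01 R},
    {in D &, forall x y : convex_lmodType E,
      (f x <| t |> f y <= f (x <| t |> y))%R}.

Definition dotv {R : realType} {k : nat} (v w : 'rV[R]_k) : R :=
  \sum_(i < k) v 0 i * w 0 i.

Definition Theta {R : realType} {k : nat} : set 'rV[R]_k :=
  [set theta | (forall i, 0 <= theta 0 i) /\ \sum_(i < k) theta 0 i = 1].

Definition Xi {R : realType} {k : nat} : set 'rV[R]_k :=
  [set xi | (forall i, 0 <= xi 0 i) /\ is_max (range (fun i => xi 0 i)) 1].

Definition Theta_of {R : realType} {k : nat} (xi : 'rV[R]_k) : set 'rV[R]_k :=
  [set theta | Theta theta /\ forall i, xi 0 i = 0 -> theta 0 i = 0].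

Definition hvec {R : realType} {k n : nat} (h : 'I_k -> 'rV[R]_n -> R)
  (x : 'rV[R]_n) : 'rV[R]_k := \row_i h i x.

(* Also equal to +oo when a = b = 0. *)
Definition ratio {R : realType} (a b : R) : \bar R :=
  if b == 0 then +oo%E else (a / b)%:E.

Definition min_ratio {R : realType} {k n : nat} (h : 'I_k -> 'rV[R]_n -> R)
    (xi : 'rV[R]_k) (x : 'rV[R]_n) : \bar R :=
  \big[Order.min/+oo%E]_(i < k) ratio (h i x) (xi 0 i).

(* The maxima f and g are written as suprema so as to be total functions; that
   they are finite and attained is part of what has to be proved. *)
Definition fmax {R : realType} {k n : nat} (Pi : set 'rV[R]_n)
    (h : 'I_k -> 'rV[R]_n -> R) (theta : 'rV[R]_k) : R :=
  sup [set dotv theta (hvec h x) | x in Pi].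

Definition gmax {R : realType} {k n : nat} (Pi : set 'rV[R]_n)
    (h : 'I_k -> 'rV[R]_n -> R) (xi : 'rV[R]_k) : R :=
  fine (ereal_sup [set min_ratio h xi x | x in Pi]).

(* Either every h_i vanishes identically on Pi, or none does.  Continuity of
   gmax fails in exactly the remaining cases: if h_i = 0 and h_j <> 0, then
   gmax is max h_j > 0 at the basis vector e_j, but 0 at e_j + eps e_i for
   every 0 < eps <= 1. *)
Definition vanish_together {R : realType} {k n : nat} (Pi : set 'rV[R]_n)
    (h : 'I_k -> 'rV[R]_n -> R) : Prop :=
  forall i j, (forall x, Pi x -> h i x = 0) -> forall x, Pi x -> h j x = 0.

(* Main.v *)
(* For every [x] in [Pi] and every [i], [min_j h j x / xi_j * xi_i <= h i x]; taking
   scalar products with [theta] gives [g xi * <theta, xi> <= f theta].  Equality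
   holds for fixed [theta] at a multiple of [h x], where [x] attains [f theta].
   For fixed [xi] the concave functions [h i - g xi * xi_i] with [xi_i <> 0] are
   nowhere simultaneously positive, so a theorem of the alternative provides
   weights [theta] with [<theta, h> <= g xi * <theta, xi>] on all of [Pi]. *)
Require Import Defs.
From HB Require Import structures.
From mathcomp Require Import all_boot all_order all_algebra.
From mathcomp Require Import all_classical all_reals all_analysis.
From mathcomp Require Import ring lra.
Import Order.TTheory GRing.Theory Num.Theory.
Import numFieldNormedType.Exports.
Local Open Scope classical_set_scope.
Local Open Scope ring_scope.

Set Implicit Arguments.
Unset Strict Implicit.
Unset Printing Implicit Defensive.

(** * Convexity and concavity expressed with plain real weights *)

Lemma convex_setP (R : numDomainType) (E : lmodType R) (A : set E) :
  convex_set A <-> forall (t : R) x y, 0 <= t -> t <= 1 -> A x -> A y ->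
    A (t *: x + (1 - t) *: y).
Proof.
split=> [cA t x y t0 t1 Ax Ay|cA x y t]; last first.
  rewrite !inE => Ax Ay; exact: cA (ge0 t) (le1 t) Ax Ay.
by have := cA x y (Itv01 t0 t1) (mem_set Ax) (mem_set Ay); rewrite inE.
Qed.

Lemma concave_functionP (R : numFieldType) (E : lmodType R) (A : set E)
    (f : E -> R) :
  concave_function A f <-> forall (t : R) x y, 0 <= t -> t <= 1 -> A x -> A y ->
    t * f x + (1 - t) * f y <= f (t *: x + (1 - t) *: y).
Proof.
split=> [cf t x y t0 t1 Ax Ay|cf t x y]; last first.
  rewrite !inE => Ax Ay; exact: cf (ge0 t) (le1 t) Ax Ay.
exact: (cf (Itv01 t0 t1) x y (mem_set Ax) (mem_set Ay)).
Qed.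

(** * A theorem of the alternative for concave functions *)

Section concave_alternative.
Context {R : realType} {E : lmodType R}.
Implicit Types (A : set E) (f g : E -> R).

Lemma concave_functionS A B f :
  A `<=` B -> concave_function B f -> concave_function A f.
Proof.
move=> AB /concave_functionP cf; apply/concave_functionP => t x y t0 t1 Ax Ay.
by apply: cf => //; exact: AB.
Qed.

Lemma concave_function_sum (I : finType) A (w : I -> R) (u : I -> E -> R) :
  (forall i, 0 <= w i) -> (forall i, concave_function A (u i)) ->
  concave_function A (fun x => \sum_i w i * u i x).
Proof.
move=> w0 cu; apply/concave_functionP => t x y t0 t1 Ax Ay.
rewrite !mulr_sumr -big_split /=; apply: ler_sum => i _.
have /concave_functionP/(_ t x y t0 t1 Ax Ay) := cu i.
move/(ler_wpM2l (w0 i)); apply: le_trans.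
by rewrite le_eqVlt; apply/orP; left; apply/eqP; ring.
Qed.

Lemma convex_set_gt0 A f :
  convex_set A -> concave_function A f ->
  convex_set (A `&` [set x | 0 < f x]).
Proof.
move=> /convex_setP cA /concave_functionP cf.
apply/convex_setP => t x y t0 t1 [Ax fx] [Ay fy]; split; first exact: cA.
apply: lt_le_trans (cf t x y t0 t1 Ax Ay).
by rewrite /= in fx fy; nra.
Qed.

(* The admissible weights are cut out by a lower bound [g y / (g y - f y)] for
   each [y] with [g y > 0] and an upper bound [- g x / (f x - g x)] for each [x]
   with [f x > 0]; if two of these bounds crossed, both functions would be
   positive at the barycenter of [x] and [y] with weights [g y - f y] and
   [f x - g x]. *)
Lemma concave_alternative2 A f g :
  convex_set A -> concave_function A f -> concave_function A g ->
  (forall x, A x -> 0 < f x -> g x <= 0) ->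
  exists t, [/\ 0 <= t, t <= 1 &
    forall x, A x -> t * f x + (1 - t) * g x <= 0].
Proof.
move=> /convex_setP cA /concave_functionP cf /concave_functionP cg fg.
have gf y : A y -> 0 < g y -> f y <= 0.
  by move=> Ay gy; rewrite leNgt; apply/negP => /(fg _ Ay); rewrite leNgt gy.
have cross x y : A x -> A y -> 0 < f x -> 0 < g y -> f x * g y <= g x * f y.
  move=> Ax Ay fx gy; rewrite leNgt; apply/negP => lt.
  have gx := fg _ Ax fx; have fy := gf _ Ay gy.
  pose d := (g y - f y) + (f x - g x); have d0 : 0 < d by rewrite /d; lra.
  pose t := (g y - f y) / d.
  have td : t * d = g y - f y by rewrite /t divfK ?gt_eqF.
  have t0 : 0 <= t by apply: divr_ge0; rewrite ?ltW//; lra.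
  have t1 : t <= 1 by rewrite ler_pdivrMr ?mul1r// /d; lra.
  have sd : (1 - t) * d = f x - g x by rewrite mulrBl td /d; ring.
  have Az := cA _ _ _ t0 t1 Ax Ay.
  have fz : 0 < f (t *: x + (1 - t) *: y).
    apply: lt_le_trans (cf _ _ _ t0 t1 Ax Ay).
    rewrite -(pmulr_lgt0 _ d0) mulrDl mulrAC td [_ * f y * d]mulrAC sd; nra.
  suff : 0 < g (t *: x + (1 - t) *: y) by rewrite ltNge fg.
  apply: lt_le_trans (cg _ _ _ t0 t1 Ax Ay).
  rewrite -(pmulr_lgt0 _ d0) mulrDl mulrAC td [_ * g y * d]mulrAC sd; nra.
(* [L] collects the lower bounds on the weight of [f]; adjoining [0] makes it nonempty and its
   supremum nonnegative even when [g] is nowhere positive on [A]. *)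
pose L := [set g y / (g y - f y) | y in A `&` [set y | 0 < g y]] `|` [set 0].
have ubL t : (forall y, A y -> 0 < g y -> g y / (g y - f y) <= t) -> 0 <= t ->
    ubound L t.
  by move=> tP t0 _ [[y [Ay gy] <-]|->//]; exact: tP.
have ubL1 : ubound L 1.
  apply: ubL => // y Ay gy; have fy := gf _ Ay gy.
  by rewrite ler_pdivrMr ?mul1r; lra.
have supL : has_sup L by split; [exists 0; right | exists 1].
exists (sup L); split.
- by apply: sup_upper_bound => //; right.
- by apply: ge_sup => //; case: supL.
move=> x Ax; have [fx|fx] := ltP 0 (f x).
- have gx := fg _ Ax fx; have d0 : 0 < f x - g x by lra.
  have : sup L <= - g x / (f x - g x).
    apply: ge_sup; first by case: supL.
    apply: ubL => [y Ay gy|]; last by apply: divr_ge0; lra.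
    have fy := gf _ Ay gy; have := cross _ _ Ax Ay fx gy.
    by rewrite ler_pdivrMr; last lra; rewrite mulrAC ler_pdivlMr; nra.
  by rewrite ler_pdivlMr//; nra.
- have [gx|gx] := ltP 0 (g x); last first.
    have s0 : 0 <= sup L by apply: sup_upper_bound => //; right.
    have s1 : sup L <= 1 by apply: ge_sup => //; case: supL.
    by nra.
  have : g x / (g x - f x) <= sup L.
    by apply: sup_upper_bound => //; left; exists x.
  by rewrite ler_pdivrMr; nra.
Qed.

(* Fan, Glicksberg and Hoffman's theorem of the alternative, without any
   topological assumption: induct by restricting to the convex subset where the
   head function is positive. *)
Lemma concave_alternative (I : finType) (u : I -> E -> R) A (s : seq I) :
  s != [::] -> convex_set A -> (forall i, concave_function A (u i)) ->
  (forall x, A x -> ~~ all (fun i => 0 < u i x) s) ->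
  exists w : I -> R, [/\ forall i, 0 <= w i, forall i, i \notin s -> w i = 0,
    \sum_i w i = 1 & forall x, A x -> \sum_i w i * u i x <= 0].
Proof.
move=> + + cu; elim: s A cu => // i s IH A cu _ cA us.
pose d j : R := (j == i)%:R.
have sumd (v : I -> R) : \sum_j d j * v j = v i.
  rewrite (bigD1 i)//= big1 ?addr0 /d ?eqxx ?mul1r// => j /negbTE ->.
  by rewrite mul0r.
have sumd1 : \sum_j d j = 1.
  by rewrite -(sumd (fun=> 1)); apply: eq_bigr => j _; rewrite mulr1.
have [s0|s0] := eqVneq s [::].
  exists d; split => [j|j||x Ax]; rewrite /d.
  - exact: ler0n.
  - by rewrite s0 inE => /negbTE ->.
  - exact: sumd1.
  - by rewrite sumd; have := us x Ax; rewrite s0 /= andbT -leNgt.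
have AB : A `&` [set x | 0 < u i x] `<=` A by move=> x [].
have [||x [Ax uix]|w [w0 ws w1 uw]] := IH (A `&` [set x | 0 < u i x]) _ s0.
- by move=> j; exact: concave_functionS (cu j).
- exact: convex_set_gt0.
- by have := us x Ax; rewrite /= uix.
(* Where [u i] is positive, the weighted sum from the induction hypothesis is nonpositive, so the
   two-function case merges it with [u i]. *)
have [|t [t0 t1 tP]] := concave_alternative2 cA (cu i)
    (concave_function_sum w0 cu).
  by move=> x Ax uix; apply: uw.
exists (fun j => t * d j + (1 - t) * w j); split => [j|j||x Ax].
- by rewrite addr_ge0// mulr_ge0// ?ler0n// subr_ge0.
- rewrite inE negb_or => /andP[/negbTE ji /ws ->].
  by rewrite /d ji !mulr0 addr0.
- by rewrite big_split /= -!mulr_sumr w1 sumd1; ring.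
- apply: le_trans (tP x Ax); rewrite -(sumd (u^~ x)) !mulr_sumr -big_split /=.
  by apply: ler_sum => j _; rewrite mulrDl !mulrA.
Qed.

End concave_alternative.

(** * Lipschitz continuity, suprema and scalar products *)

Lemma lipschitz_within_continuous (R : realType) (V : normedModType R)
    (A : set V) (f : V -> R) (L : R) :
  (forall x y, A x -> A y -> f x - f y <= L * `|x - y|) ->
  {within A, continuous f}.
Proof.
move=> fL; apply/subspace_continuousP => x Ax; apply/cvgrPdist_lt => e e0.
(* [|L| + 1] is a positive Lipschitz constant whatever the sign of [L]. *)
have d0 : 0 < e / (`|L| + 1) by rewrite divr_gt0// ltr_wpDl.
near=> y.
have Ay : A y by near: y; exact: withinT.
have xy : `|x - y| < e / (`|L| + 1).
  near: y; apply: cvg_within; exact: (cvgrPdist_lt _ _).1 (@cvg_id _ (nbhs x)) _ d0.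
rewrite ltr_pdivlMr ?ltr_wpDl// in xy.
apply: le_lt_trans xy; rewrite mulrC.
have LN : L * `|x - y| <= (`|L| + 1) * `|x - y|.
  by rewrite ler_wpM2r// (le_trans (ler_norm L))// lerDl.
have xyL := fL _ _ Ax Ay; have yxL := fL _ _ Ay Ax.
rewrite distrC in yxL.
by rewrite ler_norml lerNl opprB (le_trans xyL) ?(le_trans yxL).
Unshelve. all: by end_near. Qed.

Lemma ler_coord_norm (R : realType) (k : nat) (v : 'rV[R]_k) i :
  `|v 0 i| <= `|v|.
Proof.
rewrite [leRHS]/Num.norm /= mx_normrE.
exact: (le_bigmax _ (fun ij : 'I_1 * 'I_k => `|v ij.1 ij.2|) (0, i)).
Qed.

Lemma is_max_sup (R : realType) (A : set R) (m : R) : is_max A m -> sup A = m.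
Proof.
move=> [Am ub]; apply/eqP; rewrite eq_le; apply/andP; split.
  by apply: ge_sup => //; exists m.
by apply: sup_upper_bound => //; split; exists m.
Qed.

Lemma is_max_ereal_sup (R : realType) (A : set \bar R) (m : \bar R) :
  is_max A m -> ereal_sup A = m.
Proof.
move=> [Am ub]; apply/eqP; rewrite eq_le ereal_sup_ubound// andbT.
exact: ge_ereal_sup.
Qed.

Lemma dotvBl (R : realType) (k : nat) (u v w : 'rV[R]_k) :
  dotv (u - v) w = dotv u w - dotv v w.
Proof.
by rewrite /dotv -sumrB; apply: eq_bigr => i _; rewrite !mxE mulrBl.
Qed.

Lemma dotv_ge0 (R : realType) (k : nat) (v w : 'rV[R]_k) :
  (forall i, 0 <= v 0 i) -> (forall i, 0 <= w 0 i) -> 0 <= dotv v w.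
Proof. by move=> v0 w0; apply: sumr_ge0 => i _; rewrite mulr_ge0. Qed.

(** A zero scalar product would force [theta] to vanish where [xi] does not; it already vanishes
    where [xi] does, so its entries could not sum to 1. *)
Lemma dotv_gt0 (R : realType) (k : nat) (xi theta : 'rV[R]_k) :
  Xi xi -> Theta_of xi theta -> 0 < dotv theta xi.
Proof.
move=> [xi0 _] [[t0 t1] txi]; rewrite lt0r dotv_ge0// andbT.
apply/eqP => /(psumr_eq0P (fun i _ => mulr_ge0 (t0 i) (xi0 i))) txi0.
have /eqP := t1; rewrite big1 ?(eq_sym 0) ?oner_eq0// => i _.
have [/txi//|xin0] := eqVneq (xi 0 i) 0.
by have /eqP := txi0 i isT; rewrite mulf_eq0 (negbTE xin0) orbF => /eqP.
Qed.

(** Clearing denominators: at [xi 0 i = 0] the ratio is [+oo], and the right-hand condition is just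
    [0 <= h i x]. *)
Lemma le_min_ratioP (R : realType) (k n : nat) (h : 'I_k -> 'rV[R]_n -> R)
    (xi : 'rV[R]_k) x (r : R) :
  (forall i, 0 <= xi 0 i) -> (forall i, 0 <= h i x) ->
  (r%:E <= min_ratio h xi x)%E <-> forall i, r * xi 0 i <= h i x.
Proof.
move=> xi0 h0.
have ratioP i : ((r%:E <= Defs.ratio (h i x) (xi 0%R i))%E) = (r * xi 0 i <= h i x).
  rewrite /Defs.ratio; case: eqVneq => [->|xin0]; first by rewrite mulr0 h0 leey.
  by rewrite lee_fin ler_pdivlMr// lt0r xin0 xi0.
split=> [/bigmin_geP[_ +] i|rh].
  by move=> /(_ i isT); rewrite ratioP.
by apply: le_bigmin => [|i _]; rewrite ?leey// ratioP.
Qed.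

(** * Attainment of the maxima, properties of [fmax], and duality *)

Section minimax.
Context {R : realType} {k n : nat} {Pi : set 'rV[R]_n}.
Context {h : 'I_k -> 'rV[R]_n -> R}.
Hypothesis Pi_nonempty : Pi !=set0.
Hypothesis Pi_compact : compact Pi.
Hypothesis h_ge0 : forall i x, Pi x -> 0 <= h i x.
Hypothesis h_continuous : forall i, {within Pi, continuous (h i)}.

Implicit Types (theta xi : 'rV[R]_k).

Lemma hvec_ge0 x i : Pi x -> 0 <= hvec h x 0 i.
Proof. by move=> Px; rewrite mxE h_ge0. Qed.

Lemma h_bounded : exists2 M, 0 <= M & forall i x, Pi x -> h i x <= M.
Proof.
have ub i : exists c, Pi c /\ forall x, Pi x -> h i x <= h i c.
  have [c /set_mem Pc hc] :=
    compact_EVT_max Pi_nonempty Pi_compact (@h_continuous i).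
  by exists c; split => // x /mem_set; exact: hc.
have /choice[c cP] := ub.
exists (\sum_i h i (c i)) => [|i x Px].
  by apply: sumr_ge0 => i _; apply: h_ge0; case: (cP i).
rewrite (bigD1 i)//= (le_trans ((cP i).2 x Px))// lerDl sumr_ge0// => j _.
by apply: h_ge0; case: (cP j).
Qed.

Lemma fmax_is_max theta :
  is_max [set dotv theta (hvec h x) | x in Pi] (fmax Pi h theta).
Proof.
have cf : {within Pi, continuous (fun x => dotv theta (hvec h x))}.
  have -> : (fun x => dotv theta (hvec h x)) =
            (fun x => \sum_i theta 0 i * h i x).
    by apply/funext => x; apply: eq_bigr => i _; rewrite mxE.
  apply: continuous_big => [|i _ x].
    exact: add_continuous.
  apply: cvgM; [exact: cvg_cst | exact: h_continuous].
have [c /set_mem Pc cP] := compact_EVT_max Pi_nonempty Pi_compact cf.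
have cmax : is_max [set dotv theta (hvec h x) | x in Pi]
      (dotv theta (hvec h c)).
  by split=> [|_ [x Px <-]]; [exists c | exact/cP/mem_set].
by rewrite /fmax (is_max_sup cmax).
Qed.

Lemma fmax_attained theta :
  exists2 x, Pi x & fmax Pi h theta = dotv theta (hvec h x).
Proof. by have [[x Px <-] _] := fmax_is_max theta; exists x. Qed.

Lemma fmax_ge theta x : Pi x -> dotv theta (hvec h x) <= fmax Pi h theta.
Proof. by move=> Px; apply: (fmax_is_max theta).2; exists x. Qed.

(** A maximizer for [t1] is a competitor for [t2], which bounds the difference of the values by a
    scalar product with [t1 - t2]. *)
Lemma fmax_continuous A : {within A, continuous (fmax Pi h)}.
Proof.
have [M M0 hM] := h_bounded.
apply: (@lipschitz_within_continuous _ _ _ _ (k%:R * M)) => t1 t2 _ _.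
have [x Px ->] := fmax_attained t1.
apply: (@le_trans _ _ (dotv (t1 - t2) (hvec h x))).
  by rewrite dotvBl lerB// fmax_ge.
apply: (@le_trans _ _ (\sum_(i < k) `|t1 - t2| * M)); last first.
  by rewrite sumr_const card_ord -[leLHS]mulr_natl mulrCA mulrC.
apply: ler_sum => i _; rewrite [hvec h x 0 i]mxE.
apply: (@le_trans _ _ (`|(t1 - t2) 0 i| * h i x)).
  by rewrite ler_wpM2r ?h_ge0// ler_norm.
by rewrite ler_pM ?h_ge0 ?hM ?ler_coord_norm.
Qed.

Lemma fmax_convex A : convex_function A (fmax Pi h).
Proof.
move=> t t1 t2 _ _; have [x Px ->] := fmax_attained (conv t t1 t2 : 'rV_k).
apply: (@le_trans _ _ (t%:num * dotv t1 (hvec h x) +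
                       (1 - t%:num) * dotv t2 (hvec h x))).
  rewrite /dotv !mulr_sumr -big_split /= le_eqVlt; apply/orP; left; apply/eqP.
  by apply: eq_bigr => i _; rewrite !mxE mulrDl !mulrA.
have t0 := ge0 t; have t1' := le1 t.
by apply: lerD; apply: ler_wpM2l; rewrite ?subr_ge0 ?fmax_ge//.
Qed.

Lemma gmax_is_max xi : Xi xi ->
  is_max [set min_ratio h xi x | x in Pi] (gmax Pi h xi)%:E.
Proof.
move=> [xi0 [[i0 _ xii0] _]]; have [M M0 hM] := h_bounded.
(* A real-valued form of [min_ratio], to which the extreme value theorem applies. The default [M] is
   harmless on [Pi]: the ratio at [i0], where [xi] is 1, is at most [M]. *)
pose F x : R := \big[Num.min/M]_(i | xi 0 i != 0) (h i x / xi 0 i).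
have FE x : Pi x -> min_ratio h xi x = (F x)%:E.
  move=> Px; have h0 i := h_ge0 i Px; apply/eqP.
  rewrite eq_le; apply/andP; split.
    rewrite /F (big_morph EFin EFin_min (erefl _)); apply: le_bigmin => [|i xin0].
      rewrite /min_ratio (bigmin_inf i0)//.
      by rewrite /Defs.ratio xii0 oner_eq0 divr1 lee_fin hM.
    by rewrite /min_ratio (bigmin_inf i)// /Defs.ratio (negbTE xin0).
  apply/le_min_ratioP => // i.
  have [->|xin0] := eqVneq (xi 0 i) 0; first by rewrite mulr0.
  rewrite -ler_pdivlMr ?lt0r ?xin0 ?xi0//.
  exact: (bigmin_le_cond _ (fun j => h j x / xi 0 j)).
have cF : {within Pi, continuous F}.
  apply: continuous_big => [|i _ x].
    by move=> z; apply: continuous_min; [exact: cvg_fst | exact: cvg_snd].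
  apply: cvgM; [exact: h_continuous | exact: cvg_cst].
have [c /set_mem Pc cP] := compact_EVT_max Pi_nonempty Pi_compact cF.
have cmax : is_max [set min_ratio h xi x | x in Pi] (F c)%:E.
  split=> [|_ [x Px <-]]; first by exists c; rewrite ?FE.
  by rewrite FE// lee_fin; exact/cP/mem_set.
by rewrite /gmax (is_max_ereal_sup cmax).
Qed.

(** With [gmax_ge], this makes [gmax Pi h xi] the largest [r] such that [r * xi <= h x]
    coordinatewise for some [x] in [Pi], free of divisions and infinities. *)
Lemma gmax_attained xi : Xi xi ->
  exists2 x, Pi x & forall i, gmax Pi h xi * xi 0 i <= h i x.
Proof.
move=> Xxi; have [[x Px xE] _] := gmax_is_max Xxi; exists x => //.
apply/le_min_ratioP; first exact: Xxi.1.
- by move=> i; exact: h_ge0.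
- by rewrite xE.
Qed.

Lemma gmax_ge xi r x : Xi xi -> Pi x ->
  (forall i, r * xi 0 i <= h i x) -> r <= gmax Pi h xi.
Proof.
move=> Xxi Px rh; rewrite -lee_fin.
apply: (@le_trans _ _ (min_ratio h xi x)); last first.
  by apply: (gmax_is_max Xxi).2; exists x.
by apply/le_min_ratioP => //; [exact: Xxi.1 | move=> i; exact: h_ge0].
Qed.

Lemma gmax_ge0 xi : Xi xi -> 0 <= gmax Pi h xi.
Proof.
move=> Xxi; have [x Px] := Pi_nonempty.
by apply: (gmax_ge Xxi Px) => i; rewrite mul0r h_ge0.
Qed.

(** Weak duality, the inequality half of both the minimum and the maximum formula. *)
Lemma gmax_dotv_le theta xi : Xi xi -> Theta theta ->
  gmax Pi h xi * dotv theta xi <= fmax Pi h theta.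
Proof.
move=> Xxi [t0 _]; have [x Px gx] := gmax_attained Xxi.
apply: le_trans (fmax_ge theta Px).
rewrite mulr_sumr; apply: ler_sum => i _.
by rewrite mulrCA mxE ler_wpM2l.
Qed.

Lemma Xi_cst1 theta : Theta theta -> Xi (const_mx 1 : 'rV[R]_k).
Proof.
move=> [_ t1]; split=> [i|]; first by rewrite mxE.
split=> [|_ [i _ <-]]; last by rewrite mxE.
(* For [k = 0] the empty sum could not equal 1, so an index exists. *)
case: (pickP (predT : pred 'I_k)) => [i _|k0]; first by exists i; rewrite ?mxE.
by move: t1 => /eqP; rewrite big_pred0// eq_sym oner_eq0.
Qed.

(* The optimal dual variable is [h x] at a maximizer [x] of [<theta, h>],
   rescaled into [Xi]; if [h x = 0], both sides vanish for every [xi]. *)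
Lemma gmax_dotv_attained theta : Theta theta ->
  exists2 xi, Xi xi & gmax Pi h xi * dotv theta xi = fmax Pi h theta.
Proof.
move=> Tt; have [x Px fx] := fmax_attained theta.
suff [xi Xxi le] : exists2 xi, Xi xi &
    fmax Pi h theta <= gmax Pi h xi * dotv theta xi.
  by exists xi => //; apply/eqP; rewrite eq_le le gmax_dotv_le.
have [_ [[i0 _ _] _]] := Xi_cst1 Tt.
pose i1 := [arg max_(i > i0) h i x]%O.
have i1P i : h i x <= h i1 x by rewrite /i1; case: arg_maxP => // j _; exact.
have [h0|hn0] := eqVneq (h i1 x) 0.
  exists (const_mx 1); first exact: (Xi_cst1 Tt).
  rewrite fx /dotv big1 ?mulr_ge0//.
  - exact/gmax_ge0/(Xi_cst1 Tt).
  - by apply: dotv_ge0 => [|i]; [exact: Tt.1 | rewrite mxE].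
  - move=> i _; rewrite mxE; suff -> : h i x = 0 by rewrite mulr0.
    by apply/eqP; rewrite eq_le h_ge0// andbT -h0.
have hgt0 : 0 < h i1 x by rewrite lt0r hn0 h_ge0.
pose xi : 'rV[R]_k := \row_i (h i x / h i1 x).
have Xxi : Xi xi.
  split=> [i|]; first by rewrite mxE divr_ge0// h_ge0.
  split=> [|_ [i _ <-]]; first by exists i1 => //; rewrite mxE divff.
  by rewrite mxE ler_pdivrMr ?mul1r.
(* The scale [h i1 x] is itself a lower bound for [gmax Pi h xi], witnessed by the same [x]. *)
exists xi => //; apply: (@le_trans _ _ (h i1 x * dotv theta xi)).
  rewrite fx mulr_sumr; apply: ler_sum => i _.
  by rewrite !mxE mulrCA [h i1 x * _]mulrC divfK.
rewrite ler_wpM2r//; first by apply: dotv_ge0; [exact: Tt.1 | exact: Xxi.1].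
by apply: (gmax_ge Xxi Px) => i; rewrite mxE mulrC divfK.
Qed.

(** * Consequences of concavity: the dual minimizer and continuity of [gmax] *)

Hypothesis Pi_convex : convex_set Pi.
Hypothesis h_concave : forall i, concave_function Pi (h i).

Lemma gmax_dual_attained xi : Xi xi ->
  exists2 theta, Theta_of xi theta &
    fmax Pi h theta / dotv theta xi = gmax Pi h xi.
Proof.
move=> Xxi; have [xi0 [[i0 _ xii0] _]] := Xxi.
pose g := gmax Pi h xi.
(* Weights supported on [s] vanish wherever [xi] does, which places [theta] in [Theta_of xi]. *)
pose s := [seq i <- enum 'I_k | xi 0 i != 0].
have ms i : (i \in s) = (xi 0 i != 0) by rewrite mem_filter mem_enum andbT.
have s0 : s != [::].
  have : i0 \in s by rewrite ms xii0 oner_eq0.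
  by apply: contraTneq => ->.
have cu i : concave_function Pi (fun x => h i x - g * xi 0 i).
  apply/concave_functionP => t x y t0 t1 Px Py.
  have /concave_functionP/(_ t x y t0 t1 Px Py) := @h_concave i; lra.
have us x : Pi x -> ~~ all (fun i => 0 < h i x - g * xi 0 i) s.
  move=> Px; apply/negP => /allP gs.
  have : (min_ratio h xi x <= g%:E)%E by apply: (gmax_is_max Xxi).2; exists x.
  (* If all these functions were positive at [x], every ratio, finite or not, would exceed the
     maximum [g]. *)
  apply/negP; rewrite -ltNge; apply: lt_bigmin => [|i _]; first exact: ltry.
  rewrite /Defs.ratio; case: eqVneq => [_|xin0]; first exact: ltry.
  rewrite lte_fin ltr_pdivlMr ?lt0r ?xin0 ?xi0// -subr_gt0.
  by apply: gs; rewrite ms.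
have [w [w0 ws w1 wP]] := concave_alternative s0 Pi_convex cu us.
pose theta : 'rV[R]_k := \row_i w i.
have Tt : Theta theta.
  by split=> [i|]; [rewrite mxE | under eq_bigr do rewrite mxE].
have Txi : Theta_of xi theta.
  by split=> // i xii; rewrite mxE ws// ms xii eqxx.
exists theta => //; have d0 := dotv_gt0 Xxi Txi.
apply/eqP; rewrite eq_le ler_pdivrMr// ler_pdivlMr//.
rewrite (gmax_dotv_le Xxi Tt) andbT.
have [x Px ->] := fmax_attained theta.
rewrite -subr_le0; apply: le_trans (wP x Px).
rewrite mulr_sumr -sumrB; apply: ler_sum => i _.
by rewrite !mxE mulrBr mulrCA.
Qed.

(** Repeated midpoints: a nonnegative concave function that is positive at one endpoint is positive
    at the midpoint. *)
Lemma common_positive : (forall i, exists2 x, Pi x & 0 < h i x) ->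
  exists2 x, Pi x & forall i, 0 < h i x.
Proof.
move=> hpos; suff [x Px xP] :
    exists2 x, Pi x & {in enum 'I_k, forall i, 0 < h i x}.
  by exists x => // i; apply: xP; rewrite mem_enum.
elim: (enum 'I_k) => [|i s [y Py yP]].
  by have [x Px] := Pi_nonempty; exists x.
have [x Px xi] := hpos i.
have half1 : 1 / 2 <= 1 :> R by lra.
have half0 : 0 <= 1 / 2 :> R by lra.
exists ((1 / 2) *: x + (1 - 1 / 2) *: y); first exact: (convex_setP _).1.
move=> j; rewrite inE => js.
have /concave_functionP/(_ _ x y half0 half1 Px Py) := @h_concave j.
apply: lt_le_trans; have hx := h_ge0 j Px; have hy := h_ge0 j Py.
case/orP: js => [/eqP ji|/yP]; first by rewrite ji in hx hy *; lra.
by lra.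
Qed.

(* Moving a maximizer for [xi] towards a point [y] where all [h i] are at least
   [d > 0] makes it nearly optimal for every [eta] close to [xi], so [gmax] is
   Lipschitz with constant [M ^ 2 / d]. *)
Lemma gmax_continuous : vanish_together Pi h ->
  {within Xi, continuous (gmax Pi h)}.
Proof.
move=> vh; have [M M0 hM] := h_bounded.
have gM xi : Xi xi -> gmax Pi h xi <= M.
  move=> Xxi; have [x Px gx] := gmax_attained Xxi.
  have [_ [[i _ xii] _]] := Xxi; have := gx i; rewrite xii mulr1.
  move=> /le_trans; apply.
  exact: hM.
have [hpos|/existsNP[i0 h0]] := pselect (forall i, exists2 x, Pi x & 0 < h i x).
  have [y Py yP] := common_positive hpos.
  pose d : R := \big[Num.min/1]_i h i y.
  have d0 : 0 < d by apply: lt_bigmin => // i _; exact: yP.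
  have dh i : d <= h i y by exact: bigmin_le.
  apply: (@lipschitz_within_continuous _ _ _ _ (M * (M / d))) => xi eta Xxi Xeta.
  set e := `|xi - eta|.
  (* Chosen so that [t * d = M * e]: the gain from moving a fraction [t] towards [y] pays for
     replacing [xi] by [eta]. The value lost is at most [t * M]. *)
  pose t := M / d * e; have t0 : 0 <= t.
    by apply: mulr_ge0; [apply: divr_ge0 => //; exact: ltW|exact: normr_ge0].
  have td : t * d = M * e by rewrite /t mulrAC divfK ?gt_eqF.
  have gxi := gM _ Xxi; have gxi0 := gmax_ge0 Xxi.
  suff : (1 - t) * gmax Pi h xi <= gmax Pi h eta.
    by rewrite -mulrA -/t; nra.
  (* For [t > 1] the left side is nonpositive; otherwise [t] is a genuine convex weight. *)
  have [t1|t1] := leP t 1; last first.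
    by apply: le_trans (gmax_ge0 Xeta); nra.
  have [x Px gx] := gmax_attained Xxi.
  apply: (@gmax_ge _ _ ((1 - t) *: x + (1 - (1 - t)) *: y)) => //.
    by apply: (convex_setP _).1 => //; lra.
  move=> i; have s0 : 0 <= 1 - t by lra.
  have s1 : 1 - t <= 1 by lra.
  have /concave_functionP/(_ _ x y s0 s1 Px Py) := @h_concave i.
  apply: le_trans.
  have ei : eta 0 i <= xi 0 i + e.
    have := ler_coord_norm (eta - xi) i; rewrite distrC -/e !mxE.
    by move=> /ler_normlP[]; lra.
  have e0 : 0 <= e by exact: normr_ge0.
  have dhi := dh i; have gxii := gx i.
  have A : gmax Pi h xi * eta 0 i <= h i x + M * e by nra.
  have B : t * d <= t * h i y by rewrite ler_wpM2l.
  have C : (1 - t) * (gmax Pi h xi * eta 0 i) <= (1 - t) * (h i x + M * e).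
    by rewrite ler_wpM2l.
  have Me : 0 <= M * e by exact: mulr_ge0.
  by nra.
(* Here [h i0] vanishes on [Pi], hence so does every [h i], and [gmax] is constantly 0 on [Xi]. *)
have h00 i x : Pi x -> h i x = 0.
  apply: (vh i0) => y Py; apply/eqP; rewrite eq_le h_ge0// andbT leNgt.
  by apply/negP => hy; apply: h0; exists y.
have g0 xi : Xi xi -> gmax Pi h xi = 0.
  move=> Xxi; apply/eqP; rewrite eq_le gmax_ge0// andbT.
  have [x Px gx] := gmax_attained Xxi.
  by have [_ [[i _ xii] _]] := Xxi; have := gx i; rewrite xii mulr1 h00.
apply: (@lipschitz_within_continuous _ _ _ _ 0) => xi eta Xxi Xeta.
by rewrite !g0// subrr mul0r.
Qed.

End minimax.

Theorem theorem4p5 (R : realType) (k n : nat) (Pi : set 'rV[R]_n)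
    (h : 'I_k -> 'rV[R]_n -> R)
    (Pi_nonempty : Pi !=set0) (Pi_compact : compact Pi)
    (Pi_convex : convex_set Pi)
    (h_ge0 : forall i x, Pi x -> 0 <= h i x)
    (h_continuous : forall i, {within Pi, continuous (h i)})
    (h_concave : forall i, concave_function Pi (h i)) :
  (forall theta, Theta theta ->
     is_max [set dotv theta (hvec h x) | x in Pi] (fmax Pi h theta)) /\
  (forall xi, Xi xi ->
     is_max [set min_ratio h xi x | x in Pi] (gmax Pi h xi)%:E) /\
  {within Theta, continuous (fmax Pi h)} /\
  (vanish_together Pi h -> {within Xi, continuous (gmax Pi h)}) /\
  convex_function Theta (fmax Pi h) /\
  (forall xi, Xi xi ->
     is_min [set fmax Pi h theta / dotv theta xi | theta in Theta_of xi]
       (gmax Pi h xi)) /\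
  (forall theta, Theta theta ->
     is_max [set gmax Pi h xi * dotv theta xi | xi in Xi]
       (fmax Pi h theta)).
Proof.
split; first by move=> theta _; exact: fmax_is_max.
split; first by move=> xi; exact: gmax_is_max.
split; first exact: fmax_continuous.
split; first exact: gmax_continuous.
split; first exact: fmax_convex.
split=> [xi Xxi|theta Ttheta]; split.
- have [theta Ttheta <-] := gmax_dual_attained Pi_nonempty Pi_compact h_ge0
    h_continuous Pi_convex h_concave Xxi.
  by exists theta.
- move=> _ [theta Ttheta <-].
  rewrite ler_pdivlMr ?(dotv_gt0 Xxi)//.
  by apply: gmax_dotv_le => //; exact: Ttheta.1.
- have [xi Xxi xiE] := gmax_dotv_attained Pi_nonempty Pi_compact h_ge0
    h_continuous Ttheta.
  by exists xi.
- by move=> _ [xi Xxi <-]; exact: gmax_dotv_le.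
Qed.
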